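(* For any non-negative integer $n$ and any parameters $(p,q)$ of the two-parametric family of Bianchi IX gravitational instantons, $$\tilde a_{2n}[p+1,q]=\tilde a_{2n}[p,q+1]=\tilde a_{2n}[p,q].$$
   Context: General coefficients. Let $\sigma_1,\sigma_2,\sigma_3$ be the left-invariant 1-forms on $SU(2)\cong\mathbb S^3$ with $d\sigma_1=\sigma_2\wedge\sigma_3$ and cyclic permutations ($\int_{\mathbb S^3}|\sigma_1\wedge\sigma_2\wedge\sigma_3|=16\pi^2$). For functions $w_1,w_2,w_3,F$ of $\mu$ let $\tilde D$ be the Dirac operator (rank 4 spinors) of $d\tilde s^2 = F\left(w_1w_2w_3\,d\mu^2+\frac{w_2w_3}{w_1}\sigma_1^2+\frac{w_3w_1}{w_2}\sigma_2^2+\frac{w_1w_2}{w_3}\sigma_3^2\right)$, and consider $\mathrm{Trace}(\exp(-t\tilde D^2))\sim t^{-2}\sum_{n\ge0}\tilde a_{2n}t^n$, $t\to0^+$. Each coefficient is $\int(\cdot)\,d\mu$ of a function of $\mu$, obtained by integrating the local heat kernel coefficient of $\tilde D^2$ (times the volume density) over $\mathbb S^3$; this function of $\mu$ is again denoted $\tilde a_{2n}$, and it is a rational expression with rational coefficients in $w_1,w_2,w_3,F$ and their $\mu$-derivatives (e.g. $\tilde a_0=4F^2w_1w_2w_3$). Two-parametric family. For $p,q\in\mathbb C$, $\Re(\mu)>0$, put $\vartheta[p,q](i\mu)=\sum_{m\in\mathbb Z}\exp(-\pi(m+p)^2\mu+2\pi i(m+p)q)$, $\vartheta_2=\vartheta[\frac12,0]$,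 $\vartheta_3=\vartheta[0,0]$, $\vartheta_4=\vartheta[0,\frac12]$, and let $\partial_q\vartheta[a,b]$ denote the derivative in the second characteristic evaluated at $[a,b]$. Set (theta functions at $i\mu$, $\Lambda$ a nonzero constant) $$w_1[p,q]=-\tfrac i2\vartheta_3\vartheta_4\frac{\partial_q\vartheta[p,q+\frac12]}{e^{\pi ip}\vartheta[p,q]},\quad w_2[p,q]=\tfrac i2\vartheta_2\vartheta_4\frac{\partial_q\vartheta[p+\frac12,q+\frac12]}{e^{\pi ip}\vartheta[p,q]},$$ $$w_3[p,q]=-\tfrac12\vartheta_2\vartheta_3\frac{\partial_q\vartheta[p+\frac12,q]}{\vartheta[p,q]},\quad F[p,q]=\frac{2}{\pi\Lambda}\left(\frac{\vartheta[p,q]}{\partial_q\vartheta[p,q]}\right)^2.$$ $\tilde a_{2n}[p,q]$ is the function of $i\mu$ obtained by substituting $w_j=w_j[p,q]$, $F=F[p,q]$ in the expression for $\tilde a_{2n}$, continued to complex $\mu$ with $\Re(\mu)>0$; parameters and points where a denominator vanishes are excluded. *)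

(* Defs.v *)
From HB Require Import structures.
From mathcomp Require Import all_boot all_order all_algebra.
From mathcomp Require Import all_classical all_reals all_analysis.
From mathcomp Require Import complex ring.
From mathcomp.analysis.showcase Require summability.

Set Implicit Arguments.
Unset Strict Implicit.
Unset Printing Implicit Defensive.

Import Order.TTheory GRing.Theory Num.Theory.
Import numFieldNormedType.Exports.

Local Open Scope classical_set_scope.
Local Open Scope ring_scope.
Local Open Scope complex_scope.

(* R[i] carries its topology (and normed structure) as R[i]^o. *)

Definition cexp (R : realType) (z : R[i]) : R[i] :=
  (expR (complex.Re z))%:C * (cos (complex.Im z) +i* sin (complex.Im z)).

Definition ccos (R : realType) (z : R[i]) : R[i] :=
  (cexp ('i * z) + cexp (- ('i * z))) / 2.

Definition csin (R : realType) (z : R[i]) : R[i] :=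
  (cexp ('i * z) - cexp (- ('i * z))) / (2 * 'i).

Definition cpi (R : realType) : R[i] := (pi : R)%:C.

Definition cderive (R : realType) (f : R[i] -> R[i]) : R[i] -> R[i] :=
  derive1 (f : R[i]^o -> R[i]^o).

Definition cintegral (R : realType) (D : set R) (f : R -> R[i]) : R[i] :=
  (\int[lebesgue_measure]_(x in D) complex.Re (f x)) +i*
  (\int[lebesgue_measure]_(x in D) complex.Im (f x)).

Definition row4 (T : pzRingType) (a b c d : T) : 'rV[T]_4 :=
  \row_j nth 0 [:: a; b; c; d] j.

Definition cintegral4 (R : realType) (f : 'rV[R]_4 -> R[i]) : R[i] :=
  cintegral setT (fun a => cintegral setT (fun b =>
  cintegral setT (fun c => cintegral setT (fun d => f (row4 a b c d))))).

(** * Dirac operator of an orthonormal coframe on a 4-dimensional chart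

  Points of the chart are rows of four complex coordinates, so that the metric
  may be complex (the analytic continuation of a Riemannian one). A coframe is
  a matrix-valued function th; row a of th x holds the components of the 1-form
  theta^a, and the metric is g = sum_a theta^a (x) theta^a. Spinor fields take
  values in C^4; operators on them are applied columnwise to 4 x 4 matrices. *)

Definition pauli (R : realType) (k : nat) : 'M[R[i]]_2 :=
  \matrix_(r, c) nth 0 (nth [::] (nth [::]
    [:: [:: [:: 0; 1]; [:: 1; 0]];
        [:: [:: 0; - 'i]; [:: 'i; 0]];
        [:: [:: 1; 0]; [:: 0; -1]]] k) r) c.

(* gamma_a gamma_b + gamma_b gamma_a = - 2 delta_ab; with this sign the Dirac
   operator is sum_a gamma_a nabla_(e_a), and its square is a positive
   Laplacian. *)
Definition gamma (R : realType) (a : 'I_4) : 'M[R[i]]_4 :=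
  (if val a is k.+1 then
     block_mx 0 ('i *: pauli R k) ('i *: pauli R k) 0
   else block_mx 0 1%:M (- 1%:M) 0) : 'M[R[i]]_(2 + 2).

Lemma pauli_anticomm (R : realType) (k l : nat) : (k < 3)%N -> (l < 3)%N ->
  pauli R k *m pauli R l + pauli R l *m pauli R k = (2 *+ (k == l))%:M.
Proof.
case: k => [|[|[|//]]]; case: l => [|[|[|//]]] _ _;
  apply/matrixP=> -[[|[|//]] ?] [[|[|//]] ?];
  rewrite !mxE !big_ord_recl !big_ord0 !mxE /=;
  apply/eqP; rewrite eq_complex /= ?mulr0n ?mulr1n; apply/andP; split; apply/eqP;
  ring.
Qed.

Lemma gamma_clifford (R : realType) (a b : 'I_4) :
  gamma R a *m gamma R b + gamma R b *m gamma R a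
  = (if a == b then - 2 else 0)%:M.
Proof.
have e k l : (k < 3)%N -> (l < 3)%N ->
    ('i *: pauli R k) *m ('i *: pauli R l)
    + ('i *: pauli R l) *m ('i *: pauli R k) = (- 2 *+ (k == l))%:M.
  move=> hk hl; rewrite -!scalemxAl -!scalemxAr !scalerA -scalerDr.
  rewrite pauli_anticomm // scale_scalar_mx; congr _%:M.
  by rewrite mulrnAr -expr2 sqr_i mulN1r.
have hs (c : R[i]) : c%:M = block_mx c%:M 0 0 c%:M :> 'M[R[i]]_(2 + 2).
  exact: scalar_mx_block.
rewrite /gamma; case: a b => [[|k] hk] [[|l] hl] /=;
  rewrite !(@mulmx_block _ 2 2 2 2 2 2) (@add_block_mx _ 2 2 2 2) [RHS]hs;
  rewrite !(mul0mx, mulmx0, mul1mx, mulmx1, mulNmx, mulmxN, add0r, addr0);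
  rewrite ?(subrr, addNr) ?(e _ _ hk hl).
- by have -> : - 1%:M - 1%:M = (- 2)%:M :> 'M[R[i]]_2
    by rewrite -opprD -raddfD -raddfN.
- by rewrite raddf0.
- by rewrite raddf0.
- by rewrite -val_eqE /= eqSS; case: (k == l).
Qed.

Definition pderive (R : realType) (W : normedModType R[i]) (j : 'I_4)
    (f : 'rV[R[i]]_4 -> W) (x : 'rV[R[i]]_4) : W :=
  'D_(delta_mx 0 j) f x.

(* Column a of frame th x holds the components of the dual vector field e_a.
   It is the inverse matrix of th x, set to 0 (rather than th x, as invmx does)
   where th x is singular. *)
Definition frame (R : realType) (th : 'rV[R[i]]_4 -> 'M[R[i]]_4)
    (x : 'rV[R[i]]_4) : 'M[R[i]]_4 := (\det (th x))^-1 *: \adj (th x).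

Lemma frameE (R : realType) (th : 'rV[R[i]]_4 -> 'M[R[i]]_4)
  (x : 'rV[R[i]]_4) : th x \in unitmx -> frame th x = invmx (th x).
Proof. by rewrite /frame /invmx => ->. Qed.

(* c_abc = theta^c([e_a, e_b]) *)
Definition structure_fun (R : realType) (th : 'rV[R[i]]_4 -> 'M[R[i]]_4)
    (a b c : 'I_4) (x : 'rV[R[i]]_4) : R[i] :=
  \sum_j th x c j * \sum_k
    (frame th x k a * pderive k (fun y => frame th y j b : R[i]^o) x
     - frame th x k b * pderive k (fun y => frame th y j a : R[i]^o) x).

(* g(nabla_(e_a) e_b, e_c) for the Levi-Civita connection (Koszul formula) *)
Definition levi_civita (R : realType) (th : 'rV[R[i]]_4 -> 'M[R[i]]_4)
    (a b c : 'I_4) (x : 'rV[R[i]]_4) : R[i] :=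
  (structure_fun th a b c x - structure_fun th a c b x
   - structure_fun th b c a x) / 2.

Definition spin_connection (R : realType) (th : 'rV[R[i]]_4 -> 'M[R[i]]_4)
    (a : 'I_4) (x : 'rV[R[i]]_4) : 'M[R[i]]_4 :=
  \sum_b \sum_c (levi_civita th a b c x / 4) *: (gamma R b *m gamma R c).

Definition dirac (R : realType) (th : 'rV[R[i]]_4 -> 'M[R[i]]_4)
    (psi : 'rV[R[i]]_4 -> 'M[R[i]]_4) (x : 'rV[R[i]]_4) : 'M[R[i]]_4 :=
  \sum_a gamma R a *m
    (\sum_j frame th x j a *: pderive j psi x
     + spin_connection th a x *m psi x).

(** * Local heat kernel coefficients of the square of the Dirac operator

  For a constant covector xi (in the coordinates of the chart),
    exp(-i x.xi) D^2 exp(i x.xi) = |xi|^2 + i (D c(xi) + c(xi) D) + D^2,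
  where c(xi) is Clifford multiplication and the three terms are homogeneous
  of degree 2, 1, 0 in xi. Hence the symbol e ~ sum_k e_k of exp(-t D^2)
  satisfies
    (d/dt + |xi|^2) e_k = - i (D c(xi) + c(xi) D) e_(k-1) - D^2 e_(k-2),
  with e_0 = 1 and e_k = 0 (k > 0) at t = 0. Here heat_symbol th xi k t x is
  e_k, given by Duhamel's formula. It is the contour integral of
  exp(- t lambda) against the term of order -2-k of the resolvent symbol of
  D^2. *)

Definition covector_frame (R : realType) (th : 'rV[R[i]]_4 -> 'M[R[i]]_4)
    (xi x : 'rV[R[i]]_4) : 'rV[R[i]]_4 := xi *m frame th x.

Definition clifford (R : realType) (th : 'rV[R[i]]_4 -> 'M[R[i]]_4)
    (xi x : 'rV[R[i]]_4) : 'M[R[i]]_4 :=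
  \sum_a covector_frame th xi x 0 a *: gamma R a.

Definition covector_sqnorm (R : realType) (th : 'rV[R[i]]_4 -> 'M[R[i]]_4)
    (xi x : 'rV[R[i]]_4) : R[i] :=
  \sum_a covector_frame th xi x 0 a ^+ 2.

(* One step of the recursion, from u = e_(k-1) and v = e_(k-2) to e_k. *)
Definition duhamel (R : realType) (th : 'rV[R[i]]_4 -> 'M[R[i]]_4)
    (xi : 'rV[R[i]]_4) (u v : R -> 'rV[R[i]]_4 -> 'M[R[i]]_4)
    (t : R) (x : 'rV[R[i]]_4) : 'M[R[i]]_4 :=
  let source s :=
    'i *: (dirac th (fun y => clifford th xi y *m u s y) x
           + clifford th xi x *m dirac th (u s) x)
    + dirac th (dirac th (v s)) x in
  - \matrix_(r, c) cintegral `[0, t]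
      (fun s => cexp (- ((t - s)%:C * covector_sqnorm th xi x))
                * source s r c).

Fixpoint heat_symbol (R : realType) (th : 'rV[R[i]]_4 -> 'M[R[i]]_4)
    (xi : 'rV[R[i]]_4) (k : nat) : R -> 'rV[R[i]]_4 -> 'M[R[i]]_4 :=
  match k with
  | 0 => fun t x => (cexp (- (t%:C * covector_sqnorm th xi x)))%:M
  | k1.+1 => duhamel th xi (heat_symbol th xi k1)
      (if k1 is k2.+1 then heat_symbol th xi k2 else fun _ _ => 0)
  end.

(* The coefficient of t^(n-2) in the expansion of the trace of the heat kernel
   on the diagonal, relative to the Riemannian volume: the integral over the
   cotangent space at x of the trace of e_(2n) at t = 1, divided by (2 pi)^4.
   The covector is written sum_a zeta_a theta^a with zeta in R^4, so that the
   integrand is exp(- |zeta|^2) times a polynomial in zeta. *)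
Definition local_heat_coeff (R : realType) (th : 'rV[R[i]]_4 -> 'M[R[i]]_4)
    (n : nat) (x : 'rV[R[i]]_4) : R[i] :=
  cintegral4 (fun zeta : 'rV[R]_4 =>
    \tr (heat_symbol th (map_mx (fun r => r%:C) zeta *m th x) n.*2 1 x))
  / (2 * cpi R) ^+ 4.

(** * Bianchi IX metrics

  The coordinates are (mu, eta, phi, psi), with the Euler angles
  0 <= eta <= pi, 0 <= phi <= 2 pi, 0 <= psi <= 4 pi on SU(2):
    sigma_1 = - sin psi d eta - cos psi sin eta d phi,
    sigma_2 =   cos psi d eta - sin psi sin eta d phi,
    sigma_3 = - cos eta d phi + d psi.
  Then d sigma_1 = sigma_2 /\ sigma_3 (and cyclically) and
  sigma_1 /\ sigma_2 /\ sigma_3 = sin eta d eta /\ d phi /\ d psi. *)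

Definition sigma_form (R : realType) (x : 'rV[R[i]]_4) (k : nat)
  : 'rV[R[i]]_4 :=
  let eta := x 0 1 in let psi := x 0 3 in
  match k with
  | 1 => row4 0 (- csin psi) (- (ccos psi * csin eta)) 0
  | 2 => row4 0 (ccos psi) (- (csin psi * csin eta)) 0
  | _ => row4 0 0 (- ccos eta) 1
  end.

(* A branch, analytic near mu0, of the square root of G when G mu0 != 0:
   sqrtc is the principal square root. *)
Definition local_sqrt (R : realType) (G : R[i] -> R[i]) (mu0 mu : R[i]) : R[i] :=
  sqrtc (G mu0) * sqrtc (G mu / G mu0).

Lemma sqr_local_sqrt (R : realType) (G : R[i] -> R[i]) (mu0 mu : R[i]) :
  G mu0 != 0 -> local_sqrt G mu0 mu ^+ 2 = G mu.
Proof. by move=> G0; rewrite exprMn !sqr_sqrtc mulrC divfK. Qed.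

(* With h^2 = F w1 w2 w3, the orthonormal coframe h d mu, (h / w_j) sigma_j of
   F (w1 w2 w3 d mu^2 + (w2 w3 / w1) sigma_1^2 + (w3 w1 / w2) sigma_2^2
      + (w1 w2 / w3) sigma_3^2),
   for mu near mu0. *)
Definition bianchi_coframe (R : realType) (w1 w2 w3 F : R[i] -> R[i])
    (mu0 : R[i]) (x : 'rV[R[i]]_4) : 'M[R[i]]_4 :=
  let mu := x 0 0 in
  let h := local_sqrt (fun z => F z * w1 z * w2 z * w3 z) mu0 mu in
  \matrix_(a < 4) match val a with
    | 0 => h *: row4 1 0 0 0
    | 1 => (h / w1 mu) *: sigma_form x 1
    | 2 => (h / w2 mu) *: sigma_form x 2
    | _ => (h / w3 mu) *: sigma_form x 3
    end.

(* The coefficient a_(2n) at mu: the local heat kernel coefficient times the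
   volume density \det theta, integrated over SU(2). Only field operations and
   complex mu-derivatives are applied to w1, w2, w3, F (the square root enters
   through its square), so for holomorphic w1, w2, w3, F the value is that of
   the rational expression in these functions and their derivatives. *)
Definition bianchi_heat_coeff (R : realType) (w1 w2 w3 F : R[i] -> R[i])
    (n : nat) (mu : R[i]) : R[i] :=
  let th := bianchi_coframe w1 w2 w3 F mu in
  cintegral `[0, pi] (fun eta =>
  cintegral `[0, 2 * pi] (fun phi =>
  cintegral `[0, 4 * pi] (fun psi =>
    let x := row4 mu eta%:C phi%:C psi%:C in
    local_heat_coeff th n x * \det (th x)))).

(** * The two-parametric family

  All functions of i mu are regarded as functions of mu. *)

Definition theta (R : realType) (p q mu : R[i]) : R[i] :=
  summability.sum (fun m : int =>
    cexp (- (cpi R * (m%:~R + p) ^+ 2 * mu)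
          + 2 * cpi R * 'i * (m%:~R + p) * q) : R[i]^o).

Definition theta2 (R : realType) (mu : R[i]) : R[i] := theta (1 / 2) 0 mu.
Definition theta3 (R : realType) (mu : R[i]) : R[i] := theta 0 0 mu.
Definition theta4 (R : realType) (mu : R[i]) : R[i] := theta 0 (1 / 2) mu.

Definition dq_theta (R : realType) (p q mu : R[i]) : R[i] :=
  cderive (fun b => theta p b mu) q.

Definition inst_w1 (R : realType) (p q mu : R[i]) : R[i] :=
  - ('i / 2) * theta3 mu * theta4 mu
  * (dq_theta p (q + 1 / 2) mu / (cexp (cpi R * 'i * p) * theta p q mu)).

Definition inst_w2 (R : realType) (p q mu : R[i]) : R[i] :=
  'i / 2 * theta2 mu * theta4 mu
  * (dq_theta (p + 1 / 2) (q + 1 / 2) mu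
     / (cexp (cpi R * 'i * p) * theta p q mu)).

Definition inst_w3 (R : realType) (p q mu : R[i]) : R[i] :=
  - (1 / 2) * theta2 mu * theta3 mu
  * (dq_theta (p + 1 / 2) q mu / theta p q mu).

Definition inst_F (R : realType) (Lambda p q mu : R[i]) : R[i] :=
  2 / (cpi R * Lambda) * (theta p q mu / dq_theta p q mu) ^+ 2.

Definition inst_heat_coeff (R : realType) (Lambda : R[i]) (n : nat)
    (p q mu : R[i]) : R[i] :=
  bianchi_heat_coeff (inst_w1 p q) (inst_w2 p q) (inst_w3 p q)
    (inst_F Lambda p q) n mu.

(* The denominators in w_j, F and the metric do not vanish at mu. *)
Definition inst_admissible (R : realType) (p q mu : R[i]) : Prop :=
  [/\ theta p q mu != 0, dq_theta p q mu != 0,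
      inst_w1 p q mu != 0, inst_w2 p q mu != 0 & inst_w3 p q mu != 0].

(* Main.v *)
Require Import Defs.
From HB Require Import structures.
From mathcomp Require Import all_boot all_order all_algebra.
From mathcomp Require Import finmap.
From mathcomp Require Import all_classical all_reals all_analysis.
From mathcomp Require Import complex ring.
From mathcomp.analysis.showcase Require summability.

(** Up to a factor that cancels in the quotients, the theta functions are
  periodic in p and q, so the shift p -> p + 1 only changes the signs of w_1 and
  w_2, the shift q -> q + 1 those of w_2 and w_3, and F is unchanged. Changing
  the signs of two of the w_j leaves the metric unchanged and rotates the
  orthonormal coframe by a constant diagonal matrix of signs S with determinant
  1. This rotation is implemented on spinors by conjugation with
  U = diag (sigma_k, sigma_k), where sigma_k is the Pauli matrix of the axis
  whose sign is kept: U gamma_a U = S_aa gamma_a. Hence the whole heat symbol of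
  the rotated coframe is the conjugate by U of the original one, and the trace
  is the same after the change of variables zeta -> zeta S in the cotangent
  space.

  Limits and integrals are total functions, and no convergence or measurability
  is ever proved: every step applies to a limit a homeomorphism fixing the junk
  value 0, or to an integrand a change of sign or a reflection, and these are
  compatible with the junk values. For integrands with values in 4 x 4 matrices
  this uses that U is monomial, so that conjugation by U permutes the entries up
  to signs. *)

Import Order.TTheory GRing.Theory Num.Theory.
Import numFieldNormedType.Exports.
Local Open Scope classical_set_scope.
Local Open Scope ring_scope.
Local Open Scope complex_scope.

(** * Limits, derivatives and sums, total versions *)

(** If [f] diverges then so does [phi \o f], since [psi] would carry a limit back; both limits are
    then the default [point], which [phi] fixes. *)
Lemma lim_homeo (T : ptopologicalType) (I : Type) (F : set_system I)
    (phi psi : T -> T) (f : I -> T) :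
  ProperFilter F -> hausdorff_space T ->
  continuous phi -> continuous psi -> cancel phi psi -> phi point = point ->
  lim ((phi \o f) @ F) = phi (lim (f @ F)).
Proof.
move=> PF hT cphi cpsi phiK phi0.
have [cf|ncf] := pselect (cvg (f @ F)).
  by apply: cvg_lim => //; apply: continuous_cvg => //; exact: cphi.
rewrite [in RHS]dvgP // phi0 dvgP // => cpf; apply: ncf.
suff : f @ F --> psi (lim ((phi \o f) @ F)) by move=> /cvgP.
have fE : f = psi \o (phi \o f) by apply/funext => i /=; rewrite phiK.
rewrite {1}fE.
by apply: continuous_cvg => //; exact: cpsi.
Qed.

Lemma eq_lim (T : pnbhsType) (I : Type) (F : set_system I) (f g : I -> T) :
  f =1 g -> lim (f @ F) = lim (g @ F).
Proof. by move=> /funext ->. Qed.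

(** The difference quotient of [phi \o f] is [phi] of that of [f], and linearity makes [phi] fix the
    default value 0. *)
Lemma derive_linear_homeo (K : numFieldType) (V W : normedModType K)
    (phi : {linear W -> W}) (psi : W -> W) (f : V -> W) (x v : V) :
  continuous phi -> continuous psi -> cancel phi psi -> point = 0 :> W ->
  'D_v (phi \o f) x = phi ('D_v f x).
Proof.
move=> cphi cpsi phiK pt0.
rewrite /derive -(@lim_homeo W K _ phi psi) //; last first.
  by rewrite pt0 linear0.
by apply: eq_lim => h /=; rewrite linearZ_LR !linearB.
Qed.

Lemma mull_continuous (R : realType) (c : R[i]) :
  continuous ( *%R c : R[i]^o -> R[i]^o).
Proof. exact: (@scaler_continuous R[i] R[i]^o c). Qed.

Lemma lim_mull (R : realType) (I : Type) (F : set_system I) (c : R[i])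
    (f : I -> R[i]^o) :
  ProperFilter F -> c != 0 ->
  lim ((fun i => c * f i : R[i]^o) @ F) = c * lim (f @ F).
Proof.
move=> PF c0.
apply: (@lim_homeo R[i]^o _ _ ( *%R c) ( *%R c^-1)) => //.
- exact: mull_continuous.
- exact: mull_continuous.
- exact: mulKf.
- exact: mulr0.
Qed.

Lemma derive1_mull (R : realType) (c : R[i]) (f : R[i]^o -> R[i]^o) (x : R[i]) :
  c != 0 -> derive1 (fun z => c * f z : R[i]^o) x = c * derive1 f x.
Proof.
move=> c0; rewrite /derive1.
rewrite -lim_mull //.
apply: eq_lim => h /=.
by rewrite -mulrBr /GRing.scale /= mulrCA.
Qed.

Lemma derive1_shift (R : realType) (a : R[i]) (f : R[i]^o -> R[i]^o)
    (x : R[i]) :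
  derive1 (fun z => f (z + a)) x = derive1 f (x + a).
Proof.
by rewrite /derive1; apply: eq_lim => h /=; rewrite addrA.
Qed.

(** * Unordered sums *)

Section Sum.
Local Open Scope fset_scope.

Lemma partial_sum_fset (I : choiceType) (V : zmodType) (x : I -> V)
    (A : {fset I}) :
  summability.partial_sum x A = \sum_(i <- A) x i.
Proof. by apply/esym; exact: big_seq_fsetE. Qed.

(** The two filters of partial sums are equal, hence so are their limits, convergent or not. *)
Lemma sum_reindex (I : choiceType) (K : numDomainType) (V : normedModType K)
    (s s' : I -> I) (x : I -> V) :
  cancel s s' -> cancel s' s ->
  summability.sum (x \o s) = summability.sum x.
Proof.
have H (t t' : I -> I) (y : I -> V) (P : set V) :
    cancel t t' -> cancel t' t ->
    (summability.partial_sum y @ summability.totally)%classic P ->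
    (summability.partial_sum (y \o t) @ summability.totally)%classic P.
  (* If [B] contains the image of [A] under [t'], then its image under [t] contains [A], and both
     partial sums run over the same terms. *)
  move=> tK t'K [A _ AP]; exists [fset t' i | i in A] => // B /= sAB.
  suff -> : summability.partial_sum (y \o t) B
            = summability.partial_sum y [fset t i | i in B].
    apply: AP => /=; apply/fsubsetP => i iA.
    apply/imfsetP; exists (t' i) => //=.
    by apply: (fsubsetP sAB); apply/imfsetP; exists i.
  rewrite !partial_sum_fset big_imfset //= => i j _ _; exact: can_inj tK _ _.
move=> sK s'K; rewrite /summability.sum; congr lim; apply/seteqP; split => P.
  move=> /(H s' s _ _ s'K sK).
  have -> // : (x \o s) \o s' = x by apply/funext => i /=; rewrite s'K.
exact: H sK s'K.
Qed.

Lemma eq_sum (I : choiceType) (K : numDomainType) (V : normedModType K)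
    (x y : I -> V) :
  x =1 y -> summability.sum x = summability.sum y.
Proof. by move=> /funext ->. Qed.

Lemma sum_mull (R : realType) (I : choiceType) (c : R[i]) (x : I -> R[i]^o) :
  c != 0 -> summability.sum (fun i => c * x i : R[i]^o) = c * summability.sum x.
Proof.
move=> c0; rewrite /summability.sum.
rewrite -(@lim_mull R _ _ c _ (@summability.totally_filter I) c0).
apply: eq_lim => A /=.
by rewrite /summability.partial_sum mulr_sumr.
Qed.
End Sum.

(** * Quasi-periodicity of the theta functions *)

Lemma cexpD (R : realType) (z w : R[i]) : cexp (z + w) = cexp z * cexp w.
Proof.
case: z w => [a b] [c d]; rewrite /cexp /= expRD cosD sinD.
by apply/eqP; rewrite eq_complex /=; apply/andP; split; apply/eqP; ring.
Qed.

Lemma cexp0 (R : realType) : cexp (0 : R[i]) = 1.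
Proof.
rewrite /cexp /= expR0 cos0 sin0; exact: mulr1.
Qed.

Lemma cexp_neq0 (R : realType) (z : R[i]) : cexp z != 0.
Proof.
apply/eqP => e; have := cexpD R z (- z).
by rewrite subrr cexp0 e mul0r => /eqP; rewrite oner_eq0.
Qed.

Lemma cexp_pi (R : realType) : cexp (cpi R * 'i) = -1.
Proof.
have -> : cpi R * 'i = 0 +i* pi.
  apply/eqP; rewrite eq_complex /=.
  by rewrite !(mulr0, mulr1, mul0r, oppr0, addr0, add0r) !eqxx.
rewrite /cexp /= expR0 cospi sinpi mul1r.
by apply/eqP; rewrite eq_complex /= oppr0 !eqxx.
Qed.

Lemma cexp_2pi_int (R : realType) (m : int) : cexp (2 * cpi R * 'i * m%:~R) = 1.
Proof.
have e1 : cexp (2 * cpi R * 'i) = 1.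
  by rewrite -mulrA mulr_natl mulr2n cexpD cexp_pi mulrNN mulr1.
set c := 2 * cpi R * 'i in e1 *.
have en (n : nat) : cexp (c * n%:R) = 1.
  elim: n => [|n IH]; first by rewrite mulr0 cexp0.
  by rewrite -natr1 mulrDr mulr1 cexpD IH e1 mulr1.
case: m => n; first exact: en.
have := cexpD R (c * n.+1%:R) (- (c * n.+1%:R)).
by rewrite subrr cexp0 en mul1r NegzE rmorphN mulrN /= => <-.
Qed.

Definition theta_term (R : realType) (p q mu : R[i]) (m : int) : R[i]^o :=
  cexp (- (cpi R * (m%:~R + p) ^+ 2 * mu)
        + 2 * cpi R * 'i * (m%:~R + p) * q).

Arguments theta_term {R}.

Lemma thetaE (R : realType) (p q mu : R[i]) :
  theta p q mu = summability.sum (theta_term p q mu).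
Proof. by []. Qed.

Lemma theta_shift_p (R : realType) (p q mu : R[i]) :
  theta (p + 1) q mu = theta p q mu.
Proof.
rewrite !thetaE -(@sum_reindex _ _ _ (fun m : int => m + 1)
  (fun m : int => m - 1) (theta_term p q mu)).
- apply: (@eq_sum _ _ R[i]^o) => m /=.
  by rewrite /theta_term rmorphD /= -addrA [1 + p]addrC.
- exact: addrK.
- exact: subrK.
Qed.

Lemma theta_shift_q (R : realType) (p q mu : R[i]) :
  theta p (q + 1) mu = cexp (2 * cpi R * 'i * p) * theta p q mu.
Proof.
rewrite !thetaE -(@sum_mull _ _ _ (theta_term p q mu)) ?cexp_neq0 //.
apply: (@eq_sum _ _ R[i]^o) => m /=.
rewrite /theta_term -cexpD.
(* The extra exponent is 2 pi i (m + p); its part 2 pi i m disappears because m is an integer. *)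
have -> : - (cpi R * (m%:~R + p) ^+ 2 * mu)
    + 2 * cpi R * 'i * (m%:~R + p) * (q + 1)
  = 2 * cpi R * 'i * p + (- (cpi R * (m%:~R + p) ^+ 2 * mu)
    + 2 * cpi R * 'i * (m%:~R + p) * q) + 2 * cpi R * 'i * m%:~R by ring.
by rewrite [LHS]cexpD cexp_2pi_int mulr1.
Qed.

Lemma dq_theta_shift_p (R : realType) (p q mu : R[i]) :
  dq_theta (p + 1) q mu = dq_theta p q mu.
Proof.
rewrite /dq_theta.
have -> // : (fun b => theta (p + 1) b mu) = (fun b => theta p b mu).
by apply/funext => b; exact: theta_shift_p.
Qed.

(** The multiplier is nonzero and constant in the second characteristic, so it passes through the
    derivative. *)
Lemma dq_theta_shift_q (R : realType) (p q mu : R[i]) :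
  dq_theta p (q + 1) mu = cexp (2 * cpi R * 'i * p) * dq_theta p q mu.
Proof.
have E : (fun b => theta p (b + 1) mu)
  = (fun b => cexp (2 * cpi R * 'i * p) * theta p b mu).
  by apply/funext => b; exact: theta_shift_q.
rewrite /dq_theta /cderive -(derive1_shift _ 1 (fun b => theta p b mu)) E.
exact: (derive1_mull _ _ (fun b => theta p b mu) _ (cexp_neq0 _ _)).
Qed.

(** * Reflection and sign change of integrals *)

Section Reflection.
Context {R : realType}.
Import HBNNSimple.
Local Open Scope ereal_scope.
Local Notation mu := (@lebesgue_measure R).
Implicit Type f : R -> \bar R.

Section OppNnsfun.
Variable h : {nnsfun (measurableTypeR R) >-> R}.

(** The instances below make the reflection of a simple function a simple function again, so that it
    can enter the supremum defining an integral. *)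
Definition nnsfun_opp (x : measurableTypeR R) : R := h (- x)%R.

Lemma measurable_nnsfun_opp : measurable_fun setT nnsfun_opp.
Proof. by apply: (measurableT_comp (f := h)) => //; exact: oppr_measurable. Qed.

HB.instance Definition _ :=
  isMeasurableFun.Build _ _ _ _ nnsfun_opp measurable_nnsfun_opp.

Lemma fimfun_nnsfun_opp : finite_set (range nnsfun_opp).
Proof.
by apply: (sub_finite_set _ (fimfunP h)) => _ [x _ <-]; exists (- x)%R.
Qed.

HB.instance Definition _ := FiniteImage.Build _ _ nnsfun_opp fimfun_nnsfun_opp.

Lemma nnfun_nnsfun_opp x : (0 <= nnsfun_opp x)%R.
Proof. exact: fun_ge0. Qed.

HB.instance Definition _ := isNonNegFun.Build _ _ nnsfun_opp nnfun_nnsfun_opp.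

Lemma sintegral_opp : sintegral mu nnsfun_opp = sintegral mu h.
Proof.
rewrite !sintegralET; apply: eq_fsbigr => r _; congr (_ * _).
apply: (@lebesgue_measureN R (h @^-1` [set r])).
exact: (@measurable_funPTI _ _ _ _ h _ (measurable_set1 r)).
Qed.
End OppNnsfun.

(** Reflecting the simple functions below [g] gives simple functions below the reflected [g] with
    the same integrals. This is one inequality; applied to the reflection of [f] it gives the
    other. *)
Lemma ge0_integral_opp f : (forall x, 0 <= f x) ->
  \int[mu]_x f (- x)%R = \int[mu]_x f x.
Proof.
have H g : (forall x, 0 <= g x) -> \int[mu]_x g x <= \int[mu]_x g (- x)%R.
  move=> g0; rewrite !ge0_integralTE //.
  apply: le_ereal_sup => _ [h hg <-].
  exists (nnsfun_opp h : {nnsfun (measurableTypeR R) >-> R}).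
    by move=> x; exact: hg.
  exact: sintegral_opp.
move=> f0; apply/eqP; rewrite eq_le H // andbT.
have := H (fun x => f (- x)%R) (fun x => f0 _).
by under [X in _ <= X -> _]eq_integral do rewrite opprK.
Qed.

(* No measurability is needed: the integral of an arbitrary function is a
   difference of suprema over simple functions. *)
Lemma integral_opp f : \int[mu]_x f (- x)%R = \int[mu]_x f x.
Proof.
rewrite integralE [RHS]integralE; congr (_ - _).
- rewrite -[RHS]ge0_integral_opp //.
  by apply: eq_integral => x _; rewrite !funeposE.
- rewrite -[RHS]ge0_integral_opp //.
  by apply: eq_integral => x _; rewrite !funenegE.
Qed.

(** Negation swaps the positive and negative parts. If either part has infinite integral, [fine]
    returns 0 on both sides, including the case of infinity minus infinity. *)
Lemma fine_integralN (D : set R) f :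
  fine (\int[mu]_(x in D) - f x) = (- fine (\int[mu]_(x in D) f x))%R.
Proof.
rewrite integralE [in RHS]integralE funeposN funenegN.
have : 0 <= \int[mu]_(x in D) f^\+ x.
  by apply: integral_ge0 => x _; exact: funepos_ge0.
have : 0 <= \int[mu]_(x in D) f^\- x.
  by apply: integral_ge0 => x _; exact: funeneg_ge0.
case: (\int[mu]_(x in D) f^\- x) => [a||];
  case: (\int[mu]_(x in D) f^\+ x) => [b||] //= _ _; rewrite ?oppr0 //.
by rewrite opprB.
Qed.
End Reflection.

Lemma eq_cintegral (R : realType) (D : set R) (f g : R -> R[i]) :
  f =1 g -> cintegral D f = cintegral D g.
Proof. by move=> /funext ->. Qed.

Lemma cintegral_opp (R : realType) (f : R -> R[i]) :
  cintegral setT (fun x => f (- x)) = cintegral setT f.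
Proof.
rewrite /cintegral /Rintegral.
rewrite (integral_opp (fun x => (complex.Re (f x))%:E)).
by rewrite (integral_opp (fun x => (complex.Im (f x))%:E)).
Qed.

Lemma cintegralN (R : realType) (D : set R) (f : R -> R[i]) :
  cintegral D (fun x => - f x) = - cintegral D f.
Proof.
rewrite /cintegral /Rintegral.
have RN x : (complex.Re (- f x))%:E = (- (complex.Re (f x))%:E)%E.
  by case: (f x).
have IN x : (complex.Im (- f x))%:E = (- (complex.Im (f x))%:E)%E.
  by case: (f x).
under eq_integral do rewrite RN.
under [X in _ +i* fine X]eq_integral do rewrite IN.
by rewrite !fine_integralN.
Qed.

Lemma cintegral_signr (R : realType) (D : set R) (b : bool) (f : R -> R[i]) :
  cintegral D (fun x => (-1) ^+ b * f x) = (-1) ^+ b * cintegral D f.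
Proof.
case: b; rewrite ?expr0 ?expr1 ?mul1r ?mulN1r.
  rewrite -cintegralN; apply: eq_cintegral => x; exact: mulN1r.
by apply: eq_cintegral => x; exact: mul1r.
Qed.

Lemma cintegral_sign_arg (R : realType) (b : bool) (f : R -> R[i]) :
  cintegral setT (fun x => f ((-1) ^+ b * x)) = cintegral setT f.
Proof.
case: b; last by apply: eq_cintegral => x; rewrite mul1r.
rewrite -[RHS]cintegral_opp; apply: eq_cintegral => x.
by rewrite mulN1r.
Qed.

Lemma eq_cintegral4 (R : realType) (f g : 'rV[R]_4 -> R[i]) :
  f =1 g -> cintegral4 f = cintegral4 g.
Proof. by move=> /funext ->. Qed.

(** The signs act on each coordinate separately, so each nested integral is reflected on its own. *)
Lemma cintegral4_sign (R : realType) (s : 'I_4 -> bool)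
    (f : 'rV[R]_4 -> R[i]) :
  cintegral4 (fun x => f (\row_a ((-1) ^+ s a * x 0 a))) = cintegral4 f.
Proof.
rewrite /cintegral4.
have E a b c d : \row_i ((-1) ^+ s i * (row4 a b c d : 'rV[R]_4) 0 i)
  = row4 ((-1) ^+ s (inord 0) * a) ((-1) ^+ s (inord 1) * b)
         ((-1) ^+ s (inord 2) * c) ((-1) ^+ s (inord 3) * d).
  apply/rowP => i; rewrite !mxE.
  by case: i => [[|[|[|[|//]]]] hi] /=; congr ((-1) ^+ s _ * _);
    apply: val_inj; rewrite /= inordK.
rewrite -[RHS](cintegral_sign_arg _ (s (inord 0))); apply: eq_cintegral => a.
rewrite -[RHS](cintegral_sign_arg _ (s (inord 1))); apply: eq_cintegral => b.
rewrite -[RHS](cintegral_sign_arg _ (s (inord 2))); apply: eq_cintegral => c.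
rewrite -[RHS](cintegral_sign_arg _ (s (inord 3))); apply: eq_cintegral => d.
by rewrite E.
Qed.

(** * Change of signs of an orthonormal coframe *)

Definition sign_mx (R : realType) (s : 'I_4 -> bool) : 'M[R[i]]_4 :=
  diag_mx (\row_a (-1) ^+ s a).

Section FrameReflection.
Context {R : realType}.
Variables (s : 'I_4 -> bool) (th th' : 'rV[R[i]]_4 -> 'M[R[i]]_4).
Hypothesis thE : forall x, th' x = sign_mx R s *m th x.

Lemma sign_mxK : sign_mx R s *m sign_mx R s = 1%:M.
Proof.
rewrite /sign_mx mulmx_diag -diag_const_mx; congr diag_mx.
by apply/rowP => a; rewrite !mxE -expr2 sqrr_sign.
Qed.

Lemma frame_sign x : frame th' x = frame th x *m sign_mx R s.
Proof.
(* Where the coframe is singular both frames are 0, so the identity holds at every point and can be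
   differentiated as an identity of functions. *)
have [d0|d0] := eqVneq (\det (th x)) 0.
  by rewrite /frame thE det_mulmx d0 mulr0 invr0 !scale0r mul0mx.
have thu : th x \in unitmx by rewrite unitmxE unitfE.
have su : sign_mx R s \in unitmx by case: (mulmx1_unit sign_mxK).
have thu' : th' x \in unitmx by rewrite thE unitmx_mul su.
rewrite !frameE //; apply: (can_inj (mulmxK thu')).
rewrite mulVmx // thE mulmxA -(mulmxA _ _ (sign_mx R s)).
by rewrite sign_mxK mulmx1 mulVmx.
Qed.

Lemma frame_signE x k a : frame th' x k a = (-1) ^+ s a * frame th x k a.
Proof. by rewrite frame_sign /sign_mx mul_mx_diag !mxE mulrC. Qed.

Lemma th_signE x a j : th' x a j = (-1) ^+ s a * th x a j.
Proof. by rewrite thE /sign_mx mul_diag_mx !mxE. Qed.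

Lemma pderive_sign (b : bool) (f : 'rV[R[i]]_4 -> R[i]^o) k x :
  pderive k (fun y => (-1) ^+ b * f y : R[i]^o) x = (-1) ^+ b * pderive k f x.
Proof.
rewrite /pderive /derive -lim_mull ?signr_eq0 //.
by apply: eq_lim => h /=; rewrite -mulrBr /GRing.scale /= mulrCA.
Qed.

(** The signs are constant, so they leave the derivatives, one for each index. *)
Lemma structure_fun_sign a b c x :
  structure_fun th' a b c x
  = (-1) ^+ s a * (-1) ^+ s b * (-1) ^+ s c * structure_fun th a b c x.
Proof.
rewrite /structure_fun mulr_sumr; apply: eq_bigr => j _.
rewrite !mulr_sumr; apply: eq_bigr => k _.
have pE e : pderive k (fun y => frame th' y j e : R[i]^o) x
    = (-1) ^+ s e * pderive k (fun y => frame th y j e : R[i]^o) x.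
  rewrite -pderive_sign; congr (pderive k _ x); apply/funext => y.
  exact: frame_signE.
(* Rewriting with the sign lemmas does not terminate in reasonable time:
   comparing th' with th unfolds all definitions. *)
have alg (sa sb sc t t' fa fa' fb fb' pa pa' pb pb' : R[i]) :
    t' = sc * t -> fa' = sa * fa -> fb' = sb * fb ->
    pa' = sa * pa -> pb' = sb * pb ->
    t' * (fa' * pb' - fb' * pa') = sa * sb * sc * (t * (fa * pb - fb * pa)).
  by move=> -> -> -> -> ->; ring.
apply: alg; [exact: th_signE | exact: frame_signE | exact: frame_signE | |];
  exact: pE.
Qed.

Lemma levi_civita_sign a b c x :
  levi_civita th' a b c x
  = (-1) ^+ s a * (-1) ^+ s b * (-1) ^+ s c * levi_civita th a b c x.
Proof.
have alg (sa sb sc A A' B B' C C' : R[i]) :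
    A' = sa * sb * sc * A -> B' = sa * sc * sb * B -> C' = sb * sc * sa * C ->
    (A' - B' - C') / 2 = sa * sb * sc * ((A - B - C) / 2).
  by move=> -> -> ->; ring.
by apply: alg; exact: structure_fun_sign.
Qed.

Lemma covector_frame_sign xi x a :
  covector_frame th' xi x 0 a = (-1) ^+ s a * covector_frame th xi x 0 a.
Proof.
by rewrite /covector_frame frame_sign mulmxA /sign_mx mul_mx_diag !mxE mulrC.
Qed.

Lemma covector_sqnorm_sign xi x :
  covector_sqnorm th' xi x = covector_sqnorm th xi x.
Proof.
rewrite /covector_sqnorm.
apply: eq_bigr => a _.
have alg (b : bool) (u v : R[i]) : u = (-1) ^+ b * v -> u ^+ 2 = v ^+ 2.
  by move=> ->; rewrite exprMn sqrr_sign mul1r.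
exact: alg (covector_frame_sign xi x a).
Qed.

(** * Lift of the sign change to spinors *)

Variables (U : 'M[R[i]]_4) (e : 'I_4 -> 'I_4 -> bool) (perm4 : 'I_4 -> 'I_4).
Hypothesis UU : U *m U = 1%:M.
Hypothesis U_gamma : forall a, U *m gamma R a *m U = (-1) ^+ s a *: gamma R a.
Hypothesis U_entry : forall M r c,
  (U *m M *m U) r c = (-1) ^+ e r c * M (perm4 r) (perm4 c).

Definition conjU : 'M[R[i]]_4 -> 'M[R[i]]_4 := mulmxr U \o mulmx U.
HB.instance Definition _ := GRing.Linear.on conjU.

Lemma conjUE M : conjU M = U *m M *m U. Proof. by []. Qed.

Lemma conjUZ k M : conjU (k *: M) = k *: conjU M.
Proof. exact: linearZ. Qed.

Lemma conjUD M N : conjU (M + N) = conjU M + conjU N.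
Proof. exact: linearD. Qed.

Lemma conjUN M : conjU (- M) = - conjU M.
Proof. exact: linearN. Qed.

Lemma conjU0 : conjU 0 = 0.
Proof. exact: linear0. Qed.

Lemma conjU_sum (f : 'I_4 -> 'M[R[i]]_4) :
  conjU (\sum_a f a) = \sum_a conjU (f a).
Proof. exact: linear_sum. Qed.

Lemma conjUM M N : conjU (M *m N) = conjU M *m conjU N.
Proof.
by rewrite !conjUE !mulmxA -(mulmxA (U *m M) U U) UU mulmx1.
Qed.

Lemma conjUK : involutive conjU.
Proof.
by move=> M; rewrite !conjUE !mulmxA UU mul1mx -mulmxA UU mulmx1.
Qed.

(** Conjugation permutes the entries up to sign, hence preserves the maximum norm: the same radius
    works. *)
Lemma conjU_continuous :
  continuous (conjU : ('M[R[i]]_4 : normedModType R[i])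
                      -> ('M[R[i]]_4 : normedModType R[i])).
Proof.
pose W : normedModType R[i] := 'M[R[i]]_4.
move=> M P /= /(@nbhs_ballP _ W) [r r0 rP].
apply/(@nbhs_ballP _ W); exists r => // N [h MN].
apply: rP; split=> // i j; rewrite !conjUE !U_entry -ball_normE /ball_ /=.
rewrite -mulrBr normrMsign.
by have := MN (perm4 i) (perm4 j); rewrite -ball_normE.
Qed.

Lemma pderive_conjU f k x :
  pderive k (conjU \o f) x = conjU (pderive k f x).
Proof.
apply: derive_linear_homeo conjU_continuous conjU_continuous conjUK _.
by apply/matrixP => i j; rewrite !mxE.
Qed.

(** Of the three signs of [levi_civita], those of [b] and [c] are produced by conjugating the
    product of the two gamma matrices; only that of [a] remains. *)
Lemma spin_connection_sign a x :
  spin_connection th' a x = (-1) ^+ s a *: conjU (spin_connection th a x).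
Proof.
rewrite /spin_connection conjU_sum scaler_sumr; apply: eq_bigr => b _.
rewrite conjU_sum scaler_sumr; apply: eq_bigr => c _.
rewrite levi_civita_sign conjUZ conjUM !conjUE !U_gamma.
rewrite -scalemxAl -scalemxAr !scalerA; congr (_ *: _); ring.
Qed.

(** The sign from conjugating [gamma R a] matches the one carried by the frame vector and the spin
    connection in direction [a]. *)
Lemma dirac_conjU f x :
  Defs.dirac th' (conjU \o f) x = conjU (Defs.dirac th f x).
Proof.
rewrite /Defs.dirac conjU_sum; apply: eq_bigr => a _.
rewrite conjUM [conjU (gamma R a)]conjUE U_gamma conjUD conjU_sum /=.
rewrite -scalemxAl scalemxAr; congr (_ *m _).
rewrite scalerDr scaler_sumr; congr (_ + _).
  apply: eq_bigr => j _.
  have alg (k k' : R[i]) (M : 'M[R[i]]_4) :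
      k' = (-1) ^+ s a * k -> k' *: M = (-1) ^+ s a *: (k *: M).
    by move=> ->; rewrite scalerA.
  by rewrite pderive_conjU conjUZ; exact: alg (frame_signE x j a).
by rewrite spin_connection_sign conjUM; exact: (esym (scalemxAl _ _ _)).
Qed.

Lemma clifford_conjU xi x : clifford th' xi x = conjU (clifford th xi x).
Proof.
rewrite /clifford conjU_sum; apply: eq_bigr => a _.
have alg (k k' : R[i]) (M : 'M[R[i]]_4) :
    k' = (-1) ^+ s a * k -> k' *: M = k *: ((-1) ^+ s a *: M).
  by move=> ->; rewrite scalerA mulrC.
by rewrite conjUZ conjUE U_gamma; exact: alg (covector_frame_sign xi x a).
Qed.

(** Each entry of the conjugate is a single entry up to sign, so only oddness of the integral is
    used. *)
Lemma conjU_cintegral (D : set R) (f : R -> 'M[R[i]]_4) :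
  conjU (\matrix_(r, c) cintegral D (fun t => f t r c))
  = \matrix_(r, c) cintegral D (fun t => conjU (f t) r c).
Proof.
apply/matrixP => r c; rewrite conjUE U_entry !mxE -cintegral_signr.
by apply: eq_cintegral => t; rewrite conjUE U_entry.
Qed.

Lemma duhamel_conjU xi (u v : R -> 'rV[R[i]]_4 -> 'M[R[i]]_4) t x :
  duhamel th' xi (fun t => conjU \o u t) (fun t => conjU \o v t) t x
  = conjU (duhamel th xi u v t x).
Proof.
rewrite /duhamel conjUN; congr (- _).
set g := fun s0 : R => cexp (- ((t - s0)%:C * covector_sqnorm th xi x)).
set src := fun s0 =>
    'i *: (Defs.dirac th (fun y => clifford th xi y *m u s0 y) x
           + clifford th xi x *m Defs.dirac th (u s0) x)
    + Defs.dirac th (Defs.dirac th (v s0)) x.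
(* The exponential is absorbed into the matrix, so that [conjU_cintegral] applies to the whole
   integrand. *)
transitivity (conjU (\matrix_(r, c)
    cintegral `[0, t] (fun s0 => (g s0 *: src s0) r c))).
  rewrite conjU_cintegral; apply/matrixP => r c; rewrite [LHS]mxE [RHS]mxE.
  apply: eq_cintegral => s0; rewrite conjUZ [RHS]mxE covector_sqnorm_sign.
  congr (_ * _); congr (fun_of_matrix _ r c).
  rewrite /src conjUD conjUZ conjUD conjUM clifford_conjU dirac_conjU.
  congr (_ *: (_ + _) + _).
    rewrite -dirac_conjU; congr (Defs.dirac th' _ x); apply/funext => y /=.
    by rewrite conjUM clifford_conjU.
  rewrite -dirac_conjU; congr (Defs.dirac th' _ x); apply/funext => y /=.
  exact: dirac_conjU.
congr conjU; apply/matrixP => r c; rewrite !mxE; apply: eq_cintegral => s0.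
by rewrite mxE.
Qed.

Lemma eq_duhamel xi (u u' v v' : R -> 'rV[R[i]]_4 -> 'M[R[i]]_4) t x :
  u = u' -> v = v' -> duhamel th' xi u v t x = duhamel th' xi u' v' t x.
Proof. by move=> -> ->. Qed.

Lemma heat_symbol_conjU xi k t :
  heat_symbol th' xi k t = conjU \o heat_symbol th xi k t.
Proof.
(* The recursion has depth two, so two consecutive orders are carried through the induction. *)
have : (forall t, heat_symbol th' xi k t = conjU \o heat_symbol th xi k t) /\
  (forall t, heat_symbol th' xi k.+1 t = conjU \o heat_symbol th xi k.+1 t).
  have H0 t0 : heat_symbol th' xi 0 t0 = conjU \o heat_symbol th xi 0 t0.
    apply/funext => x /=; rewrite covector_sqnorm_sign -scalemx1 conjUZ.
    by rewrite conjUE mulmx1 UU.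
  elim: k => [|k [IH0 IH1]].
    split=> [|t0]; first exact: H0.
    apply/funext => x; rewrite [RHS]/= -duhamel_conjU.
    apply: eq_duhamel; apply/funext => t1; first exact: H0.
    (* The term of order -1 is zero, which conjugation fixes. *)
    by apply/funext => y /=; rewrite conjU0.
  split=> [|t0]; first exact: IH1.
  apply/funext => x; rewrite [RHS]/= -duhamel_conjU.
  by apply: eq_duhamel; apply/funext => t1; [exact: IH1|exact: IH0].
by case.
Qed.

Lemma mxtrace_conjU M : \tr (conjU M) = \tr M.
Proof. by rewrite conjUE mxtrace_mulC mulmxA UU mul1mx. Qed.

Lemma local_heat_coeff_sign n x :
  local_heat_coeff th' n x = local_heat_coeff th n x.
Proof.
(* The same covector has components in the two coframes that differ by the signs [s]. *)
have zE (z : 'rV[R]_4) : map_mx (fun r => r%:C) z *m th' x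
    = map_mx (fun r => r%:C) (\row_a ((-1) ^+ s a * z 0 a)) *m th x.
  rewrite thE mulmxA; congr (_ *m _); apply/rowP => a.
  by rewrite /sign_mx mul_mx_diag !mxE rmorphM rmorph_sign mulrC.
rewrite /local_heat_coeff.
apply: (congr1 (fun z => z / (2 * cpi R) ^+ 4)).
rewrite -[RHS](cintegral4_sign _ s); apply: eq_cintegral4 => z.
by rewrite heat_symbol_conjU -zE; exact: mxtrace_conjU.
Qed.
End FrameReflection.

(** * Conjugation by Pauli matrices *)

(** Index 0 is the mu direction and is kept; the axes are the indices 1, 2, 3, while [k] counts from
    0 as in [pauli]. *)
Definition flipped (k : nat) (a : 'I_4) : bool :=
  if val a is l.+1 then l != k else false.

Definition pauli_block (R : realType) (k : nat) : 'M[R[i]]_4 :=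
  (block_mx (pauli R k) 0 0 (pauli R k) : 'M[R[i]]_(2 + 2)).

Lemma pauli_sqr (R : realType) (k : nat) : (k < 3)%N ->
  pauli R k *m pauli R k = 1%:M.
Proof.
move=> k3; have := pauli_anticomm R k3 k3.
rewrite eqxx mulr1n -mulr2n -scaler_nat.
by rewrite -[2%:M]scalemx1 => /scalerI -> //; rewrite pnatr_eq0.
Qed.

Lemma pauli_conj (R : realType) (k l : nat) : (k < 3)%N -> (l < 3)%N ->
  pauli R k *m pauli R l *m pauli R k = (-1) ^+ (l != k) *: pauli R l.
Proof.
move=> k3 l3; have /(canRL (addrK _)) := pauli_anticomm R l3 k3.
rewrite -mulmxA => ->.
rewrite mulmxBr mulmxA pauli_sqr // mul1mx mul_mx_scalar.
have [->|_] := eqVneq l k; last by rewrite mulr0n scale0r add0r scaleN1r.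
by rewrite mulr1n scale1r scaler_nat mulr2n addrK.
Qed.

Lemma pauli_block_sqr (R : realType) (k : nat) : (k < 3)%N ->
  pauli_block R k *m pauli_block R k = 1%:M.
Proof.
move=> k3; rewrite /pauli_block (@mulmx_block _ 2 2 2 2 2 2).
rewrite !mul0mx !mulmx0 !addr0 !add0r pauli_sqr //.
exact/esym/(@scalar_mx_block _ 2 2).
Qed.

Lemma pauli_block_gamma (R : realType) (k : nat) (a : 'I_4) : (k < 3)%N ->
  pauli_block R k *m gamma R a *m pauli_block R k
  = (-1) ^+ flipped k a *: gamma R a.
Proof.
move=> k3; rewrite /pauli_block /gamma /flipped; case: a => [[|l] hl] /=.
  rewrite !(@mulmx_block _ 2 2 2 2 2 2) !(mul0mx, mulmx0, mulmx1, add0r, addr0).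
  by rewrite mulmxN mulNmx mulmx1 pauli_sqr // expr0 scale1r.
rewrite !(@mulmx_block _ 2 2 2 2 2 2) !(mul0mx, mulmx0, mulmx1, add0r, addr0).
rewrite -!scalemxAr -!scalemxAl pauli_conj // (@scale_block_mx _ 2 2 2 2).
by rewrite !scaler0 !scalerA mulrC.
Qed.

(** Row [i] of [U] has its only nonzero entry in column [f i]; by symmetry the columns have the same
    form, so both sums of the product collapse to one term. *)
Lemma monomial_conj (K : comNzRingType) (m : nat) (U : 'M[K]_m) (b : 'I_m -> bool)
    (f : 'I_m -> 'I_m) :
  (forall i j, U i j = (-1) ^+ b i *+ (j == f i)) -> U^T = U ->
  forall M r c,
  (U *m M *m U) r c = (-1) ^+ (b r (+) b c) * M (f r) (f c).
Proof.
move=> UE UT M r c; have UC i j : U i j = U j i by rewrite -{1}UT mxE.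
rewrite mxE (bigD1 (f c)) //= big1 ?addr0; last first.
  by move=> j jc; rewrite (UC j c) UE (negPf jc) mulr0n mulr0.
rewrite (UC (f c)) UE eqxx mulr1n mxE (bigD1 (f r)) //= big1 ?addr0; last first.
  by move=> j jc; rewrite UE (negPf jc) mulr0n mul0r.
by rewrite UE eqxx mulr1n signr_addb mulrAC.
Qed.

(* pauli R 1 is excluded because it is not symmetric. *)
Lemma pauli_block_entry (R : realType) (k : nat) : k = 0%N \/ k = 2%N ->
  exists (e : 'I_4 -> 'I_4 -> bool) (f : 'I_4 -> 'I_4), forall M r c,
  (pauli_block R k *m M *m pauli_block R k) r c = (-1) ^+ e r c * M (f r) (f c).
Proof.
move=> k02.
have [b [f bfE]] : exists (b : 'I_4 -> bool) (f : 'I_4 -> 'I_4),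
    forall i j, pauli_block R k i j = (-1) ^+ b i *+ (j == f i).
  have ord2 (P : 'I_4 -> Prop) :
      (forall i : 'I_2, P (lshift 2 i)) -> (forall i : 'I_2, P (rshift 2 i)) ->
      forall i, P i.
    by move=> Pl Pr i; case: (@split_ordP 2 2 i) => j ->.
  have ul (i j : 'I_2) :
      pauli_block R k (@lshift 2 2 i) (@lshift 2 2 j) = pauli R k i j.
    exact: (@block_mxEul _ 2 2 2 2).
  have ur (i j : 'I_2) : pauli_block R k (@lshift 2 2 i) (@rshift 2 2 j) = 0.
    by rewrite [LHS](@block_mxEur _ 2 2 2 2) mxE.
  have dl (i j : 'I_2) : pauli_block R k (@rshift 2 2 i) (@lshift 2 2 j) = 0.
    by rewrite [LHS](@block_mxEdl _ 2 2 2 2) mxE.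
  have dr (i j : 'I_2) :
      pauli_block R k (@rshift 2 2 i) (@rshift 2 2 j) = pauli R k i j.
    exact: (@block_mxEdr _ 2 2 2 2).
  have e1 (z : R[i]) (c : bool) : z = (if c then 1 else 0) -> z = 1 *+ c.
    by move=> ->; case: c.
  case: k02 ul ur dl dr => -> ul ur dl dr.
    (* The first Pauli matrix swaps the two coordinates of each block, without signs. *)
    exists (fun=> false), (fun i => inord (nth 0 [:: 1; 0; 3; 2]%N i)).
    apply: (ord2 _) => i; apply: (ord2 _) => j; rewrite ?ul ?ur ?dl ?dr expr0;
      case: i => [[|[|//]] ?]; case: j => [[|[|//]] ?];
      by apply: (e1 _ _); rewrite ?mxE -val_eqE /= inordK.
  (* The third Pauli matrix is diag (1, -1): signs at the odd indices and no permutation. *)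
  exists (fun i => odd i), id.
  apply: (ord2 _) => i; apply: (ord2 _) => j; rewrite ?ul ?ur ?dl ?dr;
    by case: i => [[|[|//]] ?]; case: j => [[|[|//]] ?];
      rewrite ?mxE -val_eqE /=.
exists (fun r c => b r (+) b c), f; apply: monomial_conj => //.
rewrite /pauli_block (@tr_block_mx _ 2 2 2 2) !trmx0.
suff -> : (pauli R k)^T = pauli R k by [].
by case: k02 => ->; apply/matrixP => -[[|[|//]] ?] [[|[|//]] ?]; rewrite !mxE.
Qed.

(** * Bianchi IX metrics *)

Section BianchiSign.
Context {R : realType}.
Variables (w1 w2 w3 w1' w2' w3' F : R[i] -> R[i]) (k : nat).
Hypothesis k02 : k = 0%N \/ k = 2%N.
Hypothesis w1E : forall z, w1' z = (-1) ^+ (0%N != k) * w1 z.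
Hypothesis w2E : forall z, w2' z = (-1) ^+ (1%N != k) * w2 z.
Hypothesis w3E : forall z, w3' z = (-1) ^+ (2%N != k) * w3 z.

Lemma bianchi_coframe_sign mu x :
  bianchi_coframe w1' w2' w3' F mu x
  = sign_mx R (flipped k) *m bianchi_coframe w1 w2 w3 F mu x.
Proof.
(* Two signs cancel in the product, so both coframes use the same branch [h] of the square root. *)
have hE : (fun z => F z * w1' z * w2' z * w3' z)
          = (fun z => F z * w1 z * w2 z * w3 z).
  apply/funext => z; rewrite w1E w2E w3E.
  by case: k02 => -> /=; rewrite expr0 expr1; ring.
rewrite /bianchi_coframe hE; set h := local_sqrt _ mu _.
have divE (b : bool) w : h / ((-1) ^+ b * w) = (-1) ^+ b * (h / w).
  by rewrite invfM invr_sign mulrCA.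
apply/matrixP => a j; rewrite /sign_mx mul_diag_mx !mxE /flipped.
case: a => [[|[|[|[|//]]]] ha] /=; rewrite ?w1E ?w2E ?w3E ?divE ?mxE ?mulrA //.
by rewrite expr0 mul1r.
Qed.

Lemma bianchi_heat_coeff_sign n mu :
  bianchi_heat_coeff w1' w2' w3' F n mu = bianchi_heat_coeff w1 w2 w3 F n mu.
Proof.
have k3 : (k < 3)%N by case: k02 => ->.
have [e [f efE]] := pauli_block_entry R _ k02.
(* Exactly two axes are flipped, so the sign matrix has determinant 1 and the volume density is
   unchanged. *)
have detE x : \det (bianchi_coframe w1' w2' w3' F mu x)
    = \det (bianchi_coframe w1 w2 w3 F mu x).
  rewrite bianchi_coframe_sign det_mulmx /sign_mx det_diag.
  rewrite !big_ord_recl big_ord0 !mxE /flipped /=.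
  by case: k02 => -> /=;
    rewrite !(expr0, expr1, mul1r, mulrNN, mulN1r, mulr1, opprK).
rewrite /bianchi_heat_coeff.
do 2!apply: eq_cintegral => ?; apply: eq_cintegral => psi.
have mulE (a a' b b' : R[i]) : a = a' -> b = b' -> a * b = a' * b'.
  by move=> -> ->.
apply: mulE; last exact: detE.
exact: (@local_heat_coeff_sign R (flipped k) _ _ (bianchi_coframe_sign mu)
  (pauli_block R k) e f (pauli_block_sqr R k k3)
  (fun a => pauli_block_gamma R k a k3) efE n).
Qed.
End BianchiSign.

(** * Effect of the two shifts on the w_j and F *)

Section Shifts.
Context {R : realType}.
Variables (Lambda p q : R[i]).

Lemma cexp_pi_shift : cexp (cpi R * 'i * (p + 1)) = - cexp (cpi R * 'i * p).
Proof. by rewrite mulrDr mulr1 cexpD cexp_pi mulrN1. Qed.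

Lemma cexp_2pi_half :
  cexp (2 * cpi R * 'i * (p + 1 / 2)) = - cexp (2 * cpi R * 'i * p).
Proof.
have -> : 2 * cpi R * 'i * (p + 1 / 2) = 2 * cpi R * 'i * p + cpi R * 'i.
  by field.
by rewrite cexpD cexp_pi mulrN1.
Qed.

Lemma divf_cancel_mul (c d e t : R[i]) :
  c != 0 -> c * d / (e * (c * t)) = d / (e * t).
Proof. by move=> c0; rewrite (mulrCA e) -mulf_div divff // mul1r. Qed.

(** The sign comes from exp(i pi p) in the denominator, a factor that [inst_w3] lacks. *)
Lemma inst_w1_shift_p mu : inst_w1 (p + 1) q mu = - inst_w1 p q mu.
Proof.
rewrite /inst_w1 dq_theta_shift_p theta_shift_p cexp_pi_shift.
by rewrite (mulNr (cexp _)) invrN !mulrN.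
Qed.

Lemma inst_w2_shift_p mu : inst_w2 (p + 1) q mu = - inst_w2 p q mu.
Proof.
rewrite /inst_w2 addrAC dq_theta_shift_p theta_shift_p cexp_pi_shift.
by rewrite (mulNr (cexp _)) invrN !mulrN.
Qed.

Lemma inst_w3_shift_p mu : inst_w3 (p + 1) q mu = inst_w3 p q mu.
Proof. by rewrite /inst_w3 addrAC dq_theta_shift_p theta_shift_p. Qed.

Lemma inst_F_shift_p mu : inst_F Lambda (p + 1) q mu = inst_F Lambda p q mu.
Proof. by rewrite /inst_F dq_theta_shift_p theta_shift_p. Qed.

Lemma inst_w1_shift_q mu : inst_w1 p (q + 1) mu = inst_w1 p q mu.
Proof.
rewrite /inst_w1 [q + 1 + _]addrAC dq_theta_shift_q theta_shift_q.
by rewrite divf_cancel_mul ?cexp_neq0.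
Qed.

(** The numerator has first characteristic p + 1/2, so its multiplier is minus that of the
    denominator. *)
Lemma inst_w2_shift_q mu : inst_w2 p (q + 1) mu = - inst_w2 p q mu.
Proof.
rewrite /inst_w2 [q + 1 + _]addrAC dq_theta_shift_q theta_shift_q cexp_2pi_half.
rewrite (mulNr (cexp _)) (mulNr (cexp _ * _)).
by rewrite divf_cancel_mul ?cexp_neq0 // mulrN.
Qed.

Lemma inst_w3_shift_q mu : inst_w3 p (q + 1) mu = - inst_w3 p q mu.
Proof.
rewrite /inst_w3 dq_theta_shift_q theta_shift_q cexp_2pi_half.
rewrite (mulNr (cexp _)) (mulNr (cexp _ * _)).
by rewrite -mulf_div divff ?cexp_neq0 // !mul1r mulrN.
Qed.

Lemma inst_F_shift_q mu : inst_F Lambda p (q + 1) mu = inst_F Lambda p q mu.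
Proof.
rewrite /inst_F dq_theta_shift_q theta_shift_q.
by rewrite -mulf_div divff ?cexp_neq0 // mul1r.
Qed.
End Shifts.

Theorem lemma8p1 (R : realType) (Lambda : R[i]) (n : nat) (p q mu : R[i])
    (hLambda : Lambda != 0) (hmu : 0 < complex.Re mu)
    (hadm : inst_admissible p q mu) :
  inst_heat_coeff Lambda n (p + 1) q mu = inst_heat_coeff Lambda n p (q + 1) mu
  /\ inst_heat_coeff Lambda n p (q + 1) mu = inst_heat_coeff Lambda n p q mu.
Proof.
have Fp : inst_F Lambda (p + 1) q = inst_F Lambda p q.
  by apply/funext => z; exact: inst_F_shift_p.
have Fq : inst_F Lambda p (q + 1) = inst_F Lambda p q.
  by apply/funext => z; exact: inst_F_shift_q.
have E_p : inst_heat_coeff Lambda n (p + 1) q mu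
    = inst_heat_coeff Lambda n p q mu.
  rewrite /inst_heat_coeff Fp.
  (* The shift of p keeps the sign of w_3, the axis of index 2. *)
  apply: (bianchi_heat_coeff_sign _ _ _ _ _ _ _ 2) => [|z|z|z].
  - by right.
  - by rewrite inst_w1_shift_p mulN1r.
  - by rewrite inst_w2_shift_p mulN1r.
  - by rewrite inst_w3_shift_p mul1r.
have E_q : inst_heat_coeff Lambda n p (q + 1) mu
    = inst_heat_coeff Lambda n p q mu.
  rewrite /inst_heat_coeff Fq.
  (* The shift of q keeps the sign of w_1, the axis of index 0. *)
  apply: (bianchi_heat_coeff_sign _ _ _ _ _ _ _ 0) => [|z|z|z].
  - by left.
  - by rewrite inst_w1_shift_q mul1r.
  - by rewrite inst_w2_shift_q mulN1r.
  - by rewrite inst_w3_shift_q mulN1r.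
exact (conj (etrans E_p (esym E_q)) E_q).
Qed.
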